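(* Fix integers $d\ge 3$ and $N\ge 3$. Let $L$ be a line in $\mathbb{P}^N$ and let $P_1,\ldots,P_d$ be different points on $L$. Fix hyperplanes $\Pi_1,\ldots,\Pi_d$ of $\mathbb{P}^N$ not containing $L$ and such that $P_i\in\Pi_i$ for $1\le i\le d$, and fix a good $P_1$-cone $C_1$ in $\Pi_1$ of degree $d$. Then there exists a smooth hypersurface $X$ of degree $d$ in $\mathbb{P}^N$ not containing $L$, having a star point at each of $P_1,\ldots,P_d$, with $T_{P_i}(X)=\Pi_i$ for $1\le i\le d$ and $T_{P_1}(X)\cap X=C_1$.
   Context: The base field is $\mathbb{C}$. For a smooth point $P$ of a hypersurface $X\subset\mathbb{P}^N$ of degree $d$, $T_P(X)$ denotes the embedded tangent hyperplane of $X$ at $P$; $P$ is a star point of $X$ if the scheme $T_P(X)\cap X$ has multiplicity $d$ at $P$ (equivalently, for $N\ge3$, it is a cone of degree $d$ with vertex $P$ in $T_P(X)$). A hypersurface $C$ of degree $d$ in a projective space $\Pi$ is a good $P$-cone of degree $d$ if it is a cone with vertex $P$ and is smooth outside $P$. *)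

(* Defs.v *)
From HB Require Import structures.
From mathcomp Require Import all_boot all_order all_algebra.
From mathcomp Require Import mpoly.

Set Implicit Arguments.
Unset Strict Implicit.
Unset Printing Implicit Defensive.

Import GRing.Theory.
Local Open Scope ring_scope.

(* Subspaces of P^(n-1) are the nonzero linear subspaces of K^n: a point is a
   {vspace 'rV[K]_n} of dimension 1, a line has dimension 2, a hyperplane has
   dimension n - 1. *)

(* Two such hypersurfaces are equal when their equations are proportional; see
   [same_hypersurface]. *)
Record hypersurface (K : closedFieldType) (n d : nat) := Hypersurface {
  equation :> {mpoly K[n]};
  equation_neq0 : equation != 0;
  equation_homog : equation \is d.-homog
}.

Definition same_hypersurface (K : closedFieldType) (n : nat)
    (f g : {mpoly K[n]}) : Prop :=
  exists2 c : K, c != 0 & f = c *: g.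

Definition contains (K : closedFieldType) (n : nat) (f : {mpoly K[n]})
    (U : {vspace 'rV[K]_n}) : Prop :=
  forall v : 'rV[K]_n, v \in U -> f.@[v 0] = 0.

(* [vpick P] is a vector of homogeneous coordinates of the point P; for a form
   f, another choice only rescales the gradient. *)
Definition gradient (K : closedFieldType) (n : nat) (f : {mpoly K[n]})
    (P : {vspace 'rV[K]_n}) : 'cV[K]_n :=
  \col_i (f^`M(i)).@[(vpick P) 0].

Definition smooth_point (K : closedFieldType) (n : nat) (f : {mpoly K[n]})
    (P : {vspace 'rV[K]_n}) : Prop :=
  contains f P /\ gradient f P != 0.

Definition smooth (K : closedFieldType) (n : nat) (f : {mpoly K[n]}) : Prop :=
  forall P : {vspace 'rV[K]_n}, \dim P = 1%N -> contains f P -> smooth_point f P.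

Definition tangent_hyperplane (K : closedFieldType) (n : nat)
    (f : {mpoly K[n]}) (P : {vspace 'rV[K]_n}) : {vspace 'rV[K]_n} :=
  lker (linfun (mulmxr (gradient f P) : 'rV[K]_n -> 'rV[K]_1)).

(* A projective subspace U is itself given homogeneous coordinates, those with
   respect to [vbasis U]; hypersurfaces in U are forms in these coordinates. *)
Definition basis_mx (K : closedFieldType) (n : nat) (U : {vspace 'rV[K]_n}) :
    'M[K]_(\dim U, n) :=
  \matrix_(i < \dim U) tnth (vbasis U) i.

Definition in_coords (K : closedFieldType) (n : nat)
    (U P : {vspace 'rV[K]_n}) : {vspace 'rV[K]_(\dim U)} :=
  (linfun (mulmxr (basis_mx U) : 'rV[K]_(\dim U) -> 'rV[K]_n) @^-1: P)%VS.

(* The equation, in the coordinates of U, of the scheme-theoretic intersection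
   of U with the zero scheme of f; it is 0 when U lies in that scheme. *)
Definition section (K : closedFieldType) (n : nat) (f : {mpoly K[n]})
    (U : {vspace 'rV[K]_n}) : {mpoly K[\dim U]} :=
  f \mPo [tuple \sum_(i < \dim U) basis_mx U i j *: 'X_i | j < n].

(* The polynomial p has order exactly m at the origin. *)
Definition has_order (K : closedFieldType) (n : nat) (p : {mpoly K[n]})
    (m : nat) : Prop :=
  (exists2 a, a \in msupp p & mdeg a = m) /\
  (forall a, a \in msupp p -> (m <= mdeg a)%N).

(* The equation of the zero scheme of f in the affine chart x_k <> 0, identified
   with the affine hyperplane x_k = v_k, translated so that v is the origin.
   The variable 'X_k does not occur in it. *)
Definition local_equation (K : closedFieldType) (n : nat) (f : {mpoly K[n]})
    (v : 'rV[K]_n) (k : 'I_n) : {mpoly K[n]} :=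
  f \mPo [tuple (v 0 j)%:MP + (if j == k then 0 else 'X_j) | j < n].

(* For a form f the order does not depend on the chart chosen. *)
Definition has_multiplicity (K : closedFieldType) (n : nat) (f : {mpoly K[n]})
    (P : {vspace 'rV[K]_n}) (m : nat) : Prop :=
  exists2 k : 'I_n, vpick P 0 k != 0 &
    has_order (local_equation f (vpick P) k) m.

Definition star_point (K : closedFieldType) (n d : nat)
    (X : hypersurface K n d) (P : {vspace 'rV[K]_n}) : Prop :=
  let T := tangent_hyperplane X P in
  smooth_point X P /\ has_multiplicity (section X T) (in_coords T P) d.

Definition cone (K : closedFieldType) (n : nat) (f : {mpoly K[n]})
    (P : {vspace 'rV[K]_n}) : Prop :=
  contains f P /\
  forall Q : {vspace 'rV[K]_n}, \dim Q = 1%N -> contains f Q ->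
    contains f (P + Q)%VS.

Definition good_cone (K : closedFieldType) (n : nat) (f : {mpoly K[n]})
    (P : {vspace 'rV[K]_n}) : Prop :=
  cone f P /\
  forall Q : {vspace 'rV[K]_n}, \dim Q = 1%N -> Q != P -> contains f Q ->
    smooth_point f Q.

(* Main.v *)
Require Import Defs.
From mathcomp Require Import all_boot all_order all_algebra.
From mathcomp Require Import mpoly complex reals ring.
From mathcomp Require boolp classical_sets cardinality lebesgue_measure.

Set Implicit Arguments.
Unset Strict Implicit.
Unset Printing Implicit Defensive.

(** The hyperplane Pi_i meets L in the single point P_i, so projecting from L
    restricts on Pi_i to the projection from P_i.  A cone with vertex P_1 in
    Pi_1 is therefore the trace on Pi_1 of one and the same cone over all of L:
    its equation extends to a form g on the whole space which is invariant
    under translation by L ([extend_good_cone]), and the goodness of the cone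
    says that g is singular along L only.  Let l_i be an equation of Pi_i and
    A = l_1 ... l_d.  Every member F = c A + g (c != 0) of the pencil restricts
    to g on each Pi_i, hence to a cone of degree d with vertex P_i, and to the
    prescribed cone on Pi_1; at P_i the differential of g vanishes, so that of
    F is a nonzero multiple of l_i, which gives the tangent hyperplane.  Since
    l_i is nonzero on L, F cannot vanish on L.

    It remains to choose c so that F is smooth.  If F is singular at x with
    A(x) = 0, say l_i(x) = 0, then the differential of g at x vanishes on Pi_i
    (where F = g) and on L (by invariance), hence everywhere; so x lies on L
    and on Pi_i, that is x = P_i, where F is smooth ([F_smooth]).  Thus one
    needs a c for which all singular points of F lie on A = 0, which is a case
    of Bertini's theorem for the pencil spanned by A and g.

    That case is proved with derivations.  Take c transcendental over the
    ring S generated by the coefficients of A and g; it exists because S is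
    countable and C is not ([exists_transcendental]).  In characteristic 0 the
    derivation d/dc of S[c] extends, one element at a time, to a ring that
    contains the coordinates of a given point x ([derivation_arcs]).  If F is
    singular at x, applying the derivation D to c A(x) + g(x) = 0 yields
    A(x) + sum_i (dF/dx_i)(x) D(x_i) = A(x) = 0 ([pencil_critical_point]). *)

Import GRing.Theory Num.Theory.
Local Open Scope ring_scope.

Local Notation eval f v := (f.@[fun_of_matrix v (0 : 'I_1)]).

(** * Polynomials along arcs *)

Section Arcs.
Context (K : numFieldType).

Lemma poly_ext (p q : {poly K}) : (forall t, p.[t] = q.[t]) -> p = q.
Proof.
move=> eq_pq; apply/eqP; rewrite -subr_eq0; apply/negPn/negP => nz.
pose s := [seq i%:R : K | i <- iota 0 (size (p - q))].
have us : uniq s.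
  by rewrite map_inj_uniq ?iota_uniq // => i j /eqP; rewrite eqr_nat => /eqP.
have /(max_poly_roots nz)/(_ us) : all (root (p - q)) s.
  by apply/allP => x _; rewrite rootE hornerD hornerN eq_pq subrr.
by rewrite size_map size_iota ltnn.
Qed.

Lemma horner_mmap n (f : {mpoly K[n]}) (xi : 'I_n -> {poly K}) t :
  (mmap polyC xi f).[t] = f.@[fun i => (xi i).[t]].
Proof.
rewrite /mmap horner_sum mevalE; apply: eq_bigr => m _.
rewrite hornerM hornerC horner_prod; congr (_ * _).
by apply: eq_bigr => i _; rewrite horner_exp.
Qed.

(** Chain rule along an arc: both sides are derivations in f, so it is enough to
    check it on the variables. *)
Lemma deriv_mmap n (f : {mpoly K[n]}) (xi : 'I_n -> {poly K}) :
  (mmap polyC xi f)^`() = \sum_i mmap polyC xi f^`M(i) * (xi i)^`().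
Proof.
pose P g := (mmap polyC xi g)^`() =
  \sum_i mmap polyC xi (mderiv i g) * (xi i)^`().
have P1 : P 1.
  rewrite /P rmorph1 derivC big1 // => i _.
  by rewrite -[1]/(1%:MP) mderivC raddf0 mul0r.
have PM g h : P g -> P h -> P (g * h).
  rewrite /P rmorphM derivM => -> ->.
  rewrite mulr_suml mulr_sumr -big_split; apply: eq_bigr => i _ /=.
  by rewrite mderivM rmorphD !rmorphM /= mulrDl mulrAC mulrA.
have PX i : P 'X_i.
  rewrite /P mmapX mmap1U (bigD1 i) //= big1 ?addr0.
    rewrite mderivX mnm1E eqxx scale1r.
    have -> : (U_(i) - U_(i))%MM = 0%MM by apply/mnmP=> j; rewrite mnmBE subnn mnm0E.
    by rewrite mpolyX0 rmorph1 mul1r.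
  move=> j /negbTE ji; rewrite mderivX mnm1E eq_sym ji scale0r.
  by rewrite raddf0 mul0r.
rewrite -/(P f); elim/mpolyind: f => [|c m p _ _ IH].
  by rewrite /P raddf0 deriv0 big1 // => i _; rewrite mderiv0 raddf0 mul0r.
have Pm : P 'X_[m].
  rewrite (mpolyXE_id _ m); apply: (big_ind P) => // i _.
  by elim: (m i) => [|k IHk]; rewrite ?expr0 // exprS; apply: PM.
rewrite /P raddfD /= derivD IH mmapZ derivM derivC mul0r add0r Pm.
rewrite mulr_sumr -big_split; apply: eq_bigr => i _ /=.
by rewrite mderivD mderivZ raddfD /= mmapZ mulrDl mulrA.
Qed.

End Arcs.

(** * Derivations and the singular points of a pencil *)

Section Derivations.
Context (K : numFieldType).

(** The image of Phi consists of arcs a + a' X + ...  The condition says that a'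
    is determined by a, so a |-> a' is a derivation, with values in K, of the
    subring of K formed by the constant terms.  Keeping the derivation as a ring
    morphism into {poly K} turns Leibniz' rule into multiplicativity. *)
Definition is_derivation (R : comNzRingType) (Phi : {rmorphism R -> {poly K}}) :=
  forall r, (Phi r)`_0 = 0 -> (Phi r)`_1 = 0.

(** Extends the derivation to the ring generated by one more element a, with
    a |-> u as its derivative. *)
Definition adjoin_arc (R : comNzRingType) (Phi : {rmorphism R -> {poly K}})
    (a u : K) : {rmorphism {poly R} -> {poly K}} :=
  (horner_eval (a%:P + u *: 'X) \o map_poly Phi : {rmorphism _ -> _}).

Lemma coef1M (p q : {poly K}) : (p * q)`_1 = p`_0 * q`_1 + p`_1 * q`_0.
Proof. by rewrite coefM big_ord_recl big_ord1. Qed.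

Section Adjoin.
Context (R : comNzRingType) (Phi : {rmorphism R -> {poly K}}) (a : K).

Let ev0 : {rmorphism R -> K} := (horner_eval 0 \o Phi : {rmorphism _ -> _}).

Lemma ev0E r : ev0 r = (Phi r)`_0.
Proof. by rewrite -horner_coef0. Qed.

Lemma adjoin_arcC u r : adjoin_arc Phi a u r%:P = Phi r.
Proof. by rewrite /= map_polyC /horner_eval hornerC. Qed.

Lemma adjoin_arcX u : adjoin_arc Phi a u 'X = a%:P + u *: 'X.
Proof. by rewrite /= map_polyX /horner_eval hornerX. Qed.

Lemma adjoin_arc_coef0 u q :
  (adjoin_arc Phi a u q)`_0 = (map_poly ev0 q).[a].
Proof.
elim/poly_ind: q => [|q c IH]; first by rewrite !rmorph0 coef0 horner0.
rewrite rmorphD rmorphM adjoin_arcC adjoin_arcX coefD coef0M IH.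
rewrite coefD coefC coefZ coefX /= mulr0 addr0.
rewrite rmorphD rmorphM /= map_polyX map_polyC hornerD hornerM hornerX hornerC.
by rewrite /= /horner_eval horner_coef0.
Qed.

Lemma adjoin_arc_coef1 u q :
  (adjoin_arc Phi a u q)`_1 =
    (adjoin_arc Phi a 0 q)`_1 + u * (map_poly ev0 q)^`().[a].
Proof.
elim/poly_ind: q => [|q c IH].
  by rewrite !rmorph0 coef0 deriv0 horner0 mulr0 addr0.
rewrite !rmorphD !rmorphM !adjoin_arcC !adjoin_arcX !coefD !coef1M IH.
rewrite !adjoin_arc_coef0 !coefD !coefZ !coefX !coefC /=.
rewrite !(mulr0, mulr1, addr0, add0r, mul0r).
rewrite map_polyX map_polyC derivD derivM derivX derivC addr0 mulr1.
rewrite hornerD hornerM hornerX; ring.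
Qed.

Context (derPhi : is_derivation Phi).

Lemma adjoin_arc_coef1_eq0 u q :
  map_poly ev0 q = 0 -> (adjoin_arc Phi a u q)`_1 = 0.
Proof.
move=> q0; rewrite /= /horner_eval horner_coef coef_sum big1 // => i _.
have c0 : (map_poly Phi q)`_i`_0 = 0.
  by rewrite coef_map -ev0E -coef_map q0 coef0.
rewrite coef1M c0 mul0r add0r coef_map derPhi ?mul0r //.
by rewrite -ev0E -coef_map q0 coef0.
Qed.

(** Every derivation extends to one more element a.  If a is transcendental over
    the constant terms, every value u will do.  Otherwise choose a relation p of
    least degree: p'(a) is nonzero by minimality and characteristic 0, so there
    is exactly one u for which p gives no contradiction; all other relations
    then follow by pseudo-division by p. *)
Lemma derivation_adjoin : exists u, is_derivation (adjoin_arc Phi a u).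
Proof.
pose rel k := boolp.asbool (exists p : {poly R},
  [/\ size (map_poly ev0 p) = k.+1 & (map_poly ev0 p).[a] = 0]).
case: (boolp.pselect (exists k, rel k)) => [exk|nok]; last first.
  exists 0 => q; rewrite adjoin_arc_coef0 => qa.
  case E : (size (map_poly ev0 q)) => [|k].
    by apply: adjoin_arc_coef1_eq0; apply/eqP; rewrite -size_poly_eq0 E.
  by case: nok; exists k; apply/boolp.asboolP; exists q.
case: (ex_minnP exk) => m /boolp.asboolP[p [szp pa]] min_m.
have min_p q : (map_poly ev0 q).[a] = 0 -> (size (map_poly ev0 q) <= m)%N ->
    map_poly ev0 q = 0.
  move=> qa; case E : (size (map_poly ev0 q)) => [|k] lek.
    by apply/eqP; rewrite -size_poly_eq0 E.
  have /min_m : rel k by apply/boolp.asboolP; exists q.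
  by rewrite leqNgt lek.
have p'a : (map_poly ev0 p)^`().[a] != 0.
  apply/eqP => p'a; have: map_poly ev0 p^`() = 0.
    apply: min_p; rewrite -deriv_map // -ltnS -szp lt_size_deriv //.
    by rewrite -size_poly_eq0 szp.
  rewrite -deriv_map => p'0.
  (* In characteristic 0 the derivative vanishes for constants only. *)
  have szp1 : size (map_poly ev0 p) = 1%N.
    apply/eqP; rewrite eqn_leq {2}szp andbT leqNgt; apply/negP => sz1.
    have := congr1 (fun r : {poly K} => r`_(m.-1)) p'0.
    rewrite coef_deriv coef0 prednK; last by rewrite szp in sz1.
    move/eqP; rewrite mulrn_eq0 eqn0Ngt.
    rewrite szp ltnS in sz1; rewrite sz1 /=.
    have -> : m = (size (map_poly ev0 p)).-1 by rewrite szp.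
    by rewrite -/(lead_coef _) lead_coef_eq0 -size_poly_eq0 szp.
  have /eqP/size_poly1P[c c0 pc] := szp1.
  by move: pa c0; rewrite pc hornerC => ->; rewrite eqxx.
exists (- (adjoin_arc Phi a 0 p)`_1 / (map_poly ev0 p)^`().[a]).
set u := (X in adjoin_arc Phi a X).
have p1 : (adjoin_arc Phi a u p)`_1 = 0.
  by rewrite adjoin_arc_coef1 /u divfK // subrr.
have p0 : (adjoin_arc Phi a u p)`_0 = 0 by rewrite adjoin_arc_coef0.
pose l := p`_m.
have l0 : ev0 l != 0.
  rewrite /l -coef_map -[m]/(m.+1.-1) -szp -/(lead_coef _).
  by rewrite lead_coef_eq0 -size_poly_eq0 szp.
move=> q; have [k] := ubnP (size (map_poly ev0 q)).
elim: k q => // k IH q; rewrite ltnS => szq q0.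
have [lem|ltm] := leqP (size (map_poly ev0 q)) m.
  by apply/adjoin_arc_coef1_eq0/min_p; rewrite // -(adjoin_arc_coef0 u) q0.
case E : (size (map_poly ev0 q)) => [|j]; first by rewrite E in ltm.
have ev_coef (r : {poly R}) i : ev0 r`_i = (map_poly ev0 r)`_i.
  by rewrite coef_map.
(* One step of pseudo-division: the top coefficient of q is cancelled after
   multiplying q by l, which is harmless since l has nonzero constant term. *)
pose q' := l%:P * q - (q`_j)%:P * 'X^(j - m) * p.
have q'0 : (adjoin_arc Phi a u q')`_0 = 0.
  by rewrite rmorphB !rmorphM coefB !coef0M q0 p0 !mulr0 subrr.
have szq' : (size (map_poly ev0 q') < k)%N.
  rewrite E in szq ltm; apply: leq_trans szq; rewrite ltnS.
  apply/leq_sizeP => i lei; rewrite -ev_coef.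
  have -> : q'`_i = l * q`_i - q`_j * p`_(i - (j - m)).
    rewrite /q' coefB -mulrA !coefCM coefXnM ltnNge.
    by rewrite (leq_trans (leq_subr m j) lei).
  rewrite rmorphB !rmorphM !ev_coef.
  have [->|nij] := eqVneq i j; first by rewrite subKn // mulrC -ev_coef subrr.
  have ltji : (j < i)%N by rewrite ltn_neqAle eq_sym nij.
  rewrite [X in _ * X]nth_default ?E // mulr0 sub0r.
  rewrite [X in _ * X]nth_default ?mulr0 ?oppr0 // szp.
  rewrite ltnS in ltm.
  by rewrite ltn_subRL subnK.
have := IH q' szq' q'0.
rewrite rmorphB !rmorphM coefB !coef1M p0 p1 q0 !mulr0 !addr0 subr0.
rewrite adjoin_arcC -ev0E => /eqP; rewrite mulf_eq0 (negbTE l0) /=.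
by move/eqP.
Qed.

End Adjoin.

(** By iterated adjunction.  The arcs through the coordinates of a point are what
    a form is evaluated at to differentiate its value at that point. *)
Lemma derivation_arcs (s : seq K) (R : comNzRingType)
    (Phi : {rmorphism R -> {poly K}}) : is_derivation Phi ->
  exists (R' : comNzRingType) (Phi' : {rmorphism R' -> {poly K}}),
    [/\ is_derivation Phi', forall r, exists r', Phi' r' = Phi r
      & forall a, a \in s -> exists r, (Phi' r)`_0 = a].
Proof.
move=> derPhi; elim: s => [|a s [R' [Phi' [der' ext' arc']]]].
  by exists R, Phi; split => // r; exists r.
have [u deru] := derivation_adjoin a der'.
exists {poly R'}, (adjoin_arc Phi' a u); split => // [r|b].
  by have [r' <-] := ext' r; exists r'%:P; rewrite adjoin_arcC.
rewrite inE => /orP[/eqP ->|/arc'[r <-]].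
  by exists 'X; rewrite adjoin_arcX coefD coefC coefZ coefX /= mulr0 addr0.
by exists r%:P; rewrite adjoin_arcC.
Qed.

Lemma mmap_image n (R : comNzRingType) (Phi : {rmorphism R -> {poly K}})
    (f : {mpoly K[n]}) (rho : 'I_n -> R) :
  (forall m, m \in msupp f -> exists r, Phi r = (f@_m)%:P) ->
  exists r, Phi r = mmap polyC (Phi \o rho) f.
Proof.
move=> coefs; rewrite /mmap big_seq.
apply: (big_ind (fun y => exists r, Phi r = y)).
- by exists 0; rewrite rmorph0.
- by move=> _ _ [r <-] [r' <-]; exists (r + r'); rewrite rmorphD.
move=> m /coefs[r Er]; exists (r * mmap1 rho m).
rewrite rmorphM Er rmorph_prod; congr (_ * _).
by apply: eq_bigr => i _; rewrite rmorphXn.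
Qed.

(** The finitely generated subring, presented as the image of an iterated
    polynomial ring over the integers, which is visibly countable. *)
Lemma countable_subring (s : seq K) :
  exists (R : countComNzRingType) (phi : {rmorphism R -> K}),
    forall a, a \in s -> exists r, phi r = a.
Proof.
elim: s => [|a s [R [phi im_phi]]].
  by exists int, (intmul 1 : {rmorphism int -> K}).
exists ({poly R} : countComNzRingType).
exists (horner_eval a \o map_poly phi : {rmorphism _ -> _}) => b.
rewrite inE => /orP[/eqP ->|/im_phi[r <-]].
  by exists 'X; rewrite /= map_polyX /horner_eval hornerX.
by exists r%:P; rewrite /= map_polyC /horner_eval hornerC.
Qed.

(** Transcendence over the image of phi: since phi may have a kernel, the
    vanishing is tested on the coefficients in K. *)
Definition transcendental (R : comNzRingType) (phi : {rmorphism R -> K}) c :=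
  forall p, root (map_poly phi p) c -> map_poly phi p = 0.

(** The infinitesimal form of Bertini's theorem.  Let D extend d/dc to the
    coordinates of x, with D = 0 on the coefficients of f and g.  Applying D to
    c f(x) + g(x) = 0 gives f(x) plus a combination of the partial derivatives
    of c f + g at x. *)
Lemma pencil_critical_point (R : comNzRingType) (phi : {rmorphism R -> K}) c
    n (f g : {mpoly K[n]}) (x : 'I_n -> K) :
  transcendental phi c ->
  (forall m, m \in msupp f -> exists r, phi r = f@_m) ->
  (forall m, m \in msupp g -> exists r, phi r = g@_m) ->
  (c *: f + g).@[x] = 0 -> (forall i, ((c *: f + g)^`M(i)).@[x] = 0) ->
  f.@[x] = 0.
Proof.
move=> trc imf img x0 dx0.
pose Phi : {rmorphism {poly R} -> {poly K}} :=
  (comp_poly ('X + c%:P) \o map_poly phi : {rmorphism _ -> _}).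
have PhiC r : Phi r%:P = (phi r)%:P by rewrite /= map_polyC comp_polyC.
have PhiX : Phi 'X = 'X + c%:P by rewrite /= map_polyX comp_polyX.
(* c is sent to the arc c + X; as c is transcendental, an element of S[c] that
   vanishes in K vanishes as a polynomial in c. *)
have derPhi : is_derivation Phi.
  move=> p; have -> : Phi p = map_poly phi p \Po ('X + c%:P) by [].
  rewrite -horner_coef0 horner_comp hornerD hornerX hornerC add0r.
  by move/eqP/trc => pz; rewrite [map_poly _ _]pz comp_poly0 coef0.
have [R' [Psi [derPsi ext arc]]] := derivation_arcs (codom x) derPhi.
have /fin_all_exists[rho rhox] i : exists r, (Psi r)`_0 = x i.
  by apply: arc; apply: codom_f.
have imC a : (exists r, phi r = a) -> exists r, Psi r = a%:P.
  by case=> r <-; rewrite -PhiC; apply: ext.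
have [rf Ef] : exists r, Psi r = mmap polyC (Psi \o rho) f.
  by apply: mmap_image => m /imf; apply: imC.
have [rg Eg] : exists r, Psi r = mmap polyC (Psi \o rho) g.
  by apply: mmap_image => m /img; apply: imC.
have [rc Ec] := ext 'X.
have at0 (h : {mpoly K[n]}) : (mmap polyC (Psi \o rho) h)`_0 = h.@[x].
  rewrite -horner_coef0 horner_mmap; apply: meval_eq => i /=.
  by rewrite horner_coef0.
have at1 (h : {mpoly K[n]}) : (mmap polyC (Psi \o rho) h)`_1 =
    \sum_i (h^`M(i)).@[x] * (Psi (rho i))`_1.
  have -> (p : {poly K}) : p`_1 = (p^`())`_0 by rewrite coef_deriv.
  rewrite deriv_mmap coef_sum; apply: eq_bigr => i _.
  by rewrite coef0M at0 coef_deriv.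
have := derPsi (rc * rf + rg).
rewrite rmorphD rmorphM Ef Eg Ec PhiX !coefD coef0M coef1M !coefD !coefX !coefC.
rewrite /= !at0 !add0r addr0 mul1r -mevalZ -mevalD => /(_ x0).
rewrite addrAC !at1 mulr_sumr -big_split big1 ?add0r // => i _ /=.
by rewrite mulrA -mulrDl -mevalZ -mevalD -mderivZ -mderivD dx0 mul0r.
Qed.

End Derivations.

(** * Transcendental complex numbers *)

Section Uncountability.
Import boolp classical_sets cardinality lebesgue_measure.

(** Countably many nonzero polynomials have countably many roots, which cannot
    exhaust even the real numbers of the interval [0, 1]. *)
Lemma exists_transcendental (R : realType) (S : countComNzRingType)
    (phi : {rmorphism S -> complex R}) : exists c, transcendental phi c.
Proof.
pose Z (p : {poly S}) : set R :=
  mkset (fun x => map_poly phi p != 0 /\ root (map_poly phi p) (x%:C)%C).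
have cZ p : countable (Z p).
  apply: finite_set_countable.
  have [p0|nz] := eqVneq (map_poly phi p) 0.
    apply: (@sub_finite_set _ _ set0); last exact: finite_set0.
    by move=> x [/eqP].
  have [s Es] := closed_field_poly_normal (map_poly phi p).
  apply: (@sub_finite_set _ _ [set` [seq @complex.Re R z | z <- s]]); last exact: finite_seq.
  move=> x [_ rx]; rewrite /= -[x]/(complex.Re (x%:C)%C); apply: map_f.
  by move: rx; rewrite Es rootZ ?lead_coef_eq0 // root_prod_XsubC.
apply: contrapT => noc.
have cT : countable (bigcup setT Z).
  apply: bigcup_countable => [|p _]; last exact: cZ.
  exact: (@cardinality.countableP {poly S}).
have sub : subset (mkset (fun x : R => x \in `[0, 1])) (bigcup setT Z).
  move=> x _; apply: contrapT => nx; apply: noc; exists (x%:C)%C => p rp.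
  by apply/eqP/negPn/negP => nz; apply: nx; exists p.
have := countable_lebesgue_measure0 (sub_countable (subset_card_le sub) cT).
rewrite lebesgue_measure_itv /= constructive_ereal.lte_fin ltr01.
by rewrite constructive_ereal.sube0 => -[]; apply/eqP; rewrite oner_eq0.
Qed.

End Uncountability.

(** * Differentials of forms *)

Section Differential.
Context (K : numFieldType).

(** By definition [gradient f P] is [grad f (vpick P)]. *)
Definition grad n (f : {mpoly K[n]}) (v : 'rV[K]_n) : 'cV[K]_n :=
  \col_i (f^`M(i)).@[v 0].

Definition restrict_line n (f : {mpoly K[n]}) (v w : 'rV[K]_n) : {poly K} :=
  mmap polyC (fun i => (v 0 i)%:P + w 0 i *: 'X) f.

Lemma horner_restrict_line n (f : {mpoly K[n]}) v w t :
  (restrict_line f v w).[t] = eval f (v + t *: w).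
Proof.
rewrite horner_mmap; apply: meval_eq => i.
by rewrite hornerD hornerC hornerZ hornerX !mxE mulrC.
Qed.

Lemma deriv_restrict_line n (f : {mpoly K[n]}) v w :
  (restrict_line f v w)^`().[0] = (w *m grad f v) 0 0.
Proof.
rewrite deriv_mmap horner_sum mxE; apply: eq_bigr => i _.
rewrite hornerM horner_mmap derivD derivC derivZ derivX add0r hornerZ hornerC.
rewrite mulr1 mulrC mxE; congr (_ * _); apply: meval_eq => j.
by rewrite hornerD hornerC hornerZ hornerX mulr0 addr0.
Qed.

(** Invariance under translation, vanishing on a subspace and the chain rule for
    linear maps are all used in this form: two polynomials that agree along
    parametrized lines have the same derivative along them. *)
Lemma grad_ext n m (f : {mpoly K[n]}) (g : {mpoly K[m]}) v w v' w' :
  (forall t, eval f (v + t *: w) = eval g (v' + t *: w')) ->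
  w *m grad f v = w' *m grad g v'.
Proof.
move=> fg; apply/matrixP => i j; rewrite !ord1 -!deriv_restrict_line.
by congr (_^`().[0]); apply: poly_ext => t; rewrite !horner_restrict_line.
Qed.

Lemma grad_eq0 n (f : {mpoly K[n]}) v :
  (forall w : 'rV_n, w *m grad f v = 0) -> grad f v = 0.
Proof.
by move=> z; apply/row_matrixP => i; rewrite rowE z row0.
Qed.

Lemma gradD n (f g : {mpoly K[n]}) v : grad (f + g) v = grad f v + grad g v.
Proof. by apply/colP => i; rewrite !mxE mderivD mevalD. Qed.

Lemma gradZ n c (f : {mpoly K[n]}) v : grad (c *: f) v = c *: grad f v.
Proof. by apply/colP => i; rewrite !mxE mderivZ mevalZ. Qed.

Lemma gradM n (f g : {mpoly K[n]}) v :
  grad (f * g) v = g.@[v 0] *: grad f v + f.@[v 0] *: grad g v.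
Proof.
by apply/colP => i; rewrite !mxE mderivM mevalD !mevalM; congr (_ + _); rewrite mulrC.
Qed.

(** The partial derivatives of f vanish identically as well, by differentiating
    along the coordinate axes; so each coefficient is seen, up to a nonzero
    integer factor, as the constant term of an iterated derivative. *)
Lemma mpoly_fun_eq0 n (f : {mpoly K[n]}) :
  (forall v : 'rV_n, f.@[v 0] = 0) -> f = 0.
Proof.
move=> f0; apply/mpolyP => m; rewrite mcoeff0.
have [k] := ubnP (mdeg m); elim: k => // k IH in f f0 m *.
rewrite ltnS => lemk.
have [->|/eqP nz] := eqVneq m 0%MM.
  have := f0 0; rewrite mevalE => <-.
  rewrite (bigID (pred1 0%MM)) /= [X in _ = _ + X]big1 ?addr0.
    have [z|nz] := boolP (0%MM \in msupp f).
      rewrite -big_filter filter_pred1_uniq ?msupp_uniq // big_seq1.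
      by rewrite big1 ?mulr1 // => i _; rewrite mnm0E expr0.
    rewrite big1_seq; first by apply: memN_msupp_eq0.
    by move=> j /andP[/eqP ->]; rewrite (negbTE nz).
  move=> j nj; have [i ji] : exists i, j i != 0%N.
    apply/existsP; rewrite -negb_forall; apply: contra nj => /forallP z.
    by apply/eqP/mnmP => i; rewrite mnm0E; apply/eqP.
  by rewrite (bigD1 i) //= !mxE expr0n (negbTE ji) mul0r mulr0.
have [i mi] : exists i, m i != 0%N.
  apply/existsP; rewrite -negb_forall; apply/negP => /forallP z; apply: nz.
  by apply/mnmP => i; rewrite mnm0E; apply/eqP.
have Em : (m - U_(i) + U_(i))%MM = m.
  apply: submK; apply/mnm_lepP => j; rewrite mnm1E.
  by case: eqP => // <-; rewrite lt0n.
have df0 (v : 'rV_n) : (f^`M(i)).@[v 0] = 0.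
  have /matrixP E : delta_mx 0 i *m grad f v = (0 : 'rV_n) *m grad f v.
    by apply: grad_ext => t; rewrite !f0.
  by move: (E 0 0); rewrite mul0mx -rowE !mxE.
have dm : (mdeg (m - U_(i))%MM < k)%N.
  by apply: leq_trans lemk; rewrite -[in X in (_ < X)%N]Em mdegD mdeg1 addn1.
have := IH _ df0 _ dm.
by rewrite mcoeff_mderiv Em => /eqP; rewrite mulrn_eq0 => /eqP.
Qed.

Lemma mpoly_fun_ext n (f g : {mpoly K[n]}) :
  (forall v : 'rV_n, f.@[v 0] = g.@[v 0]) -> f = g.
Proof.
move=> fg; apply/eqP; rewrite -subr_eq0; apply/eqP/mpoly_fun_eq0 => v.
by rewrite mevalB fg subrr.
Qed.

Section Homogeneous.
Context (n d : nat) (f : {mpoly K[n]}).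
Context (homf : f \is d.-homog).

Lemma meval_scale t (v : 'rV_n) : eval f (t *: v) = t ^+ d * f.@[v 0].
Proof.
rewrite !mevalE mulr_sumr !big_seq; apply: eq_bigr => m mf.
have <- : mdeg m = d := dhomog_mf homf mf.
rewrite mulrCA; congr (_ * _); rewrite mdegE -prodrXr.
by rewrite -big_split; apply: eq_bigr => i _ /=; rewrite mxE exprMn.
Qed.

(** Euler's relation, read off from f((1 + t) v) = (1 + t)^d f(v). *)
Lemma euler v : (0 < d)%N -> grad f v = 0 -> f.@[v 0] = 0.
Proof.
move=> d0 dv; have := deriv_restrict_line f v v; rewrite dv mulmx0 mxE.
have -> : restrict_line f v v = f.@[v 0] *: ('X + 1%:P) ^+ d.
  apply: poly_ext => t; rewrite horner_restrict_line hornerZ horner_exp.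
  rewrite hornerD hornerX hornerC mulrC -meval_scale.
  by rewrite scalerDl scale1r addrC.
rewrite derivZ deriv_exp derivD derivX derivC addr0 mul1r hornerZ hornerMn.
rewrite horner_exp hornerD hornerX hornerC add0r expr1n => /eqP.
by rewrite mulf_eq0 pnatr_eq0 eqn0Ngt d0 orbF => /eqP.
Qed.

Lemma grad_scale s v : s != 0 -> grad f v = 0 -> grad f (s *: v) = 0.
Proof.
move=> s0 dv; apply: grad_eq0 => w.
rewrite (grad_ext (g := s ^+ d *: f) (v' := v) (w' := s^-1 *: w)).
  by rewrite gradZ dv scaler0 mulmx0.
move=> t; rewrite mevalZ -meval_scale scalerDr !scalerA mulrAC.
by rewrite divff // mul1r.
Qed.

Lemma grad_origin : (1 < d)%N -> grad f 0 = 0.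
Proof.
move=> d1; apply: grad_eq0 => w; apply/matrixP => i j; rewrite !ord1.
rewrite -deriv_restrict_line.
have -> : restrict_line f 0 w = eval f w *: 'X^d.
  apply: poly_ext => t; rewrite horner_restrict_line hornerZ hornerXn mulrC.
  by rewrite -meval_scale add0r.
have /negbTE d1' : d.-1 != 0%N by rewrite -lt0n -ltnS prednK // ltnW.
by rewrite derivZ derivXn hornerZ hornerMn hornerXn expr0n d1' mul0rn mulr0 mxE.
Qed.

End Homogeneous.

Lemma dhomog_comp n m d (f : {mpoly K[n]}) (q : n.-tuple {mpoly K[m]}) :
  f \is d.-homog -> (forall i, tnth q i \is 1.-homog) -> f \mPo q \is d.-homog.
Proof.
move=> homf homq; rewrite comp_mpolyE big_seq; apply: rpred_sum => k kf.
have <- : mdeg k = d := dhomog_mf homf kf.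
apply: rpredZ; rewrite mdegE; elim/big_rec2: _ => [|i e g _ IH].
  exact: dhomog1.
by apply: dhomogM IH; have := dhomogMn (k i) (homq i); rewrite mul1n.
Qed.

(** The form v |-> f (v M).  With [M := basis_mx U] this is [section f U]. *)
Definition pullback n m (M : 'M[K]_(n, m)) (f : {mpoly K[m]}) : {mpoly K[n]} :=
  f \mPo [tuple \sum_(i < n) M i j *: 'X_i | j < m].

Lemma eval_pullback n m (M : 'M[K]_(n, m)) f (v : 'rV_n) :
  eval (pullback M f) v = eval f (v *m M).
Proof.
rewrite comp_mpoly_meval; apply: meval_eq => j; rewrite tnth_mktuple mxE.
by rewrite raddf_sum; apply: eq_bigr => i _; rewrite /= mevalZ mevalXU mulrC.
Qed.

Lemma linear_homog n (c : 'I_n -> K) :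
  \sum_(i < n) c i *: 'X_i \is [in K[n], 1.-homog].
Proof. by apply: rpred_sum => i _; apply: rpredZ; rewrite dhomogX /= mdeg1. Qed.

Lemma pullback_homog n m (M : 'M[K]_(n, m)) f d :
  f \is d.-homog -> pullback M f \is d.-homog.
Proof.
by move=> homf; apply: dhomog_comp => // j; rewrite tnth_mktuple linear_homog.
Qed.

Lemma grad_pullback n m (M : 'M[K]_(n, m)) f (v w : 'rV_n) :
  w *m grad (pullback M f) v = (w *m M) *m grad f (v *m M).
Proof.
by apply: grad_ext => t; rewrite eval_pullback mulmxDl scalemxAl.
Qed.

Definition linear_form n (a : 'cV[K]_n) : {mpoly K[n]} := \sum_i a i 0 *: 'X_i.

Lemma eval_linear_form n (a : 'cV[K]_n) (v : 'rV_n) :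
  eval (linear_form a) v = (v *m a) 0 0.
Proof.
rewrite raddf_sum mxE; apply: eq_bigr => i _.
by rewrite /= mevalZ mevalXU mulrC.
Qed.

Lemma grad_linear_form n (a : 'cV[K]_n) v : grad (linear_form a) v = a.
Proof.
apply/row_matrixP => i; rewrite !rowE; apply/matrixP => j k; rewrite !ord1.
rewrite -deriv_restrict_line.
have -> : restrict_line (linear_form a) v (delta_mx 0 i) =
    ((v *m a) 0 0)%:P + ((delta_mx 0 i : 'rV_n) *m a) 0 0 *: 'X.
  apply: poly_ext => t; rewrite horner_restrict_line eval_linear_form.
  by rewrite mulmxDl -scalemxAl !mxE hornerD hornerC hornerZ hornerX mulrC.
by rewrite derivD derivC derivZ derivX add0r hornerZ hornerC mulr1.
Qed.

End Differential.

(** * Points, hyperplanes and coordinates *)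

Section Subspaces.
Context (K : closedFieldType) (n : nat).
Implicit Types (P U : {vspace 'rV[K]_n}).

Lemma vpick_neq0 P : \dim P = 1%N -> vpick P != 0.
Proof. by rewrite vpick0 -dimv_eq0 => ->. Qed.

Lemma point_eq P v : \dim P = 1%N -> v \in P -> v != 0 -> P = <[v]>%VS.
Proof.
move=> dP vP v0; apply/esym/eqP; rewrite eqEdim dP dim_vline v0 andbT.
by rewrite -memvE.
Qed.

Lemma mem_ker (a : 'cV[K]_n) (v : 'rV_n) :
  (v \in lker (linfun (mulmxr a : 'rV[K]_n -> 'rV[K]_1))) = (v *m a == 0).
Proof. by rewrite memv_ker lfunE. Qed.

Lemma basis_mx_in U (w : 'rV[K]_(\dim U)) : w *m basis_mx U \in U.
Proof.
rewrite mulmx_sum_row; apply: memv_suml => i _; apply: memvZ.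
by rewrite rowK vbasis_mem // mem_tnth.
Qed.

Lemma basis_mxP U v : v \in U -> exists w, v = w *m basis_mx U.
Proof.
move=> vU; exists (\row_i coord (vbasis U) i v).
rewrite {1}(coord_vbasis vU) mulmx_sum_row; apply: eq_bigr => i _.
by rewrite rowK mxE (tnth_nth 0).
Qed.

Lemma basis_mx_free U : row_free (basis_mx U).
Proof.
apply: inj_row_free => w w0; apply/rowP => i; rewrite mxE.
have /freeP fr := basis_free (vbasisP U); apply: (fr (w 0)).
rewrite -[RHS]w0 mulmx_sum_row; apply: eq_bigr => j _.
by rewrite rowK (tnth_nth 0).
Qed.

Lemma mem_in_coords U P w : (w \in in_coords U P) = (w *m basis_mx U \in P).
Proof. by rewrite -memv_preim lfunE. Qed.

End Subspaces.

Lemma hyperplane_equation (K : closedFieldType) N (U : {vspace 'rV[K]_N.+1}) :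
  \dim U = N -> exists a : 'cV[K]_N.+1, forall v, (v \in U) = (v *m a == 0).
Proof.
move=> dU; have : kermx (basis_mx U)^T != 0.
  rewrite -mxrank_eq0 mxrank_ker mxrank_tr (eqP (basis_mx_free U)) dU.
  by rewrite subSnn.
case/rowV0Pn => b /sub_kermxP bB b0; exists b^T.
have Ba : basis_mx U *m b^T = 0.
  by rewrite -[LHS]trmxK trmx_mul trmxK bB trmx0.
suff -> : U = lker (linfun (mulmxr b^T : 'rV[K]_N.+1 -> 'rV[K]_1)).
  by move=> v; rewrite mem_ker.
apply/eqP; rewrite eqEdim; apply/andP; split.
  by apply/subvP => v /basis_mxP[w ->]; rewrite mem_ker -mulmxA Ba mulmx0.
set phi := linfun _.
have := limg_ker_dim phi fullv; rewrite capfv dimvf dU /dim /= mul1n => dk.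
suff : \dim (limg phi) != 0%N.
  move: (\dim (lker phi)) (\dim (limg phi)) dk => l [|k] //.
  by rewrite addnS => -[<-] _; apply: leq_addr.
rewrite dimv_eq0.
apply: contra b0 => /eqP im0; apply/eqP/rowP => i; rewrite mxE.
have : phi (delta_mx 0 i) \in 0%VS by rewrite -im0 memv_img ?memvf.
by rewrite memv0 lfunE /= -rowE => /eqP/matrixP/(_ 0 0); rewrite !mxE.
Qed.

(** * Cones *)

Section Cones.
Context (K : numClosedFieldType) (n d : nat) (f : {mpoly K[n]}).
Context (homf : f \is d.-homog).

Lemma eval_origin : (0 < d)%N -> eval f 0 = 0.
Proof.
move=> d0; by rewrite -(scale0r 0) (meval_scale homf) expr0n eqn0Ngt d0 mul0r.
Qed.

Lemma contains_line v : eval f v = 0 -> contains f <[v]>%VS.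
Proof.
by move=> fv w /vlineP[t ->]; rewrite (meval_scale homf) fv mulr0.
Qed.

(** A set-theoretic cone is invariant under translation by its vertex even as a
    function.  On its zeros this is the definition.  If f(v) != 0, then f has no
    zero on the line v + t w, since translating such a zero back would give
    f(v) = 0; a polynomial in t without roots is constant. *)
Lemma cone_translate P v w : cone f P -> w \in P -> eval f (v + w) = eval f v.
Proof.
case=> fP coneP wP.
have vanish u x : x \in P -> eval f u = 0 -> eval f (u + x) = 0.
  move=> xP fu; have [->|u0] := eqVneq u 0; first by rewrite add0r fP.
  apply: (coneP <[u]>%VS); rewrite ?dim_vline ?u0 //.
    exact: contains_line.
  by rewrite addrC memv_add ?memv_line.
have [fv|fv] := eqVneq (eval f v) 0; first by rewrite fv vanish.
have noroot t : (restrict_line f v w).[t] != 0.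
  rewrite horner_restrict_line; apply: contra fv => /eqP fvt.
  by rewrite -[v](addrK (t *: w)) vanish // rpredN rpredZ.
have /size_poly1P[c _ rc] : size (restrict_line f v w) == 1%N.
  by apply/negPn/closed_rootP => -[t /eqP]; apply/eqP/noroot.
have := horner_restrict_line f v w 1; have := horner_restrict_line f v w 0.
by rewrite rc !hornerC scale0r addr0 scale1r => <- <-.
Qed.

(** Translating the vertex to the origin does not change f, so the local equation
    is f restricted to the hyperplane x_k = 0: again a form of degree d.  It is
    nonzero because every vector is a translate, along the vertex, of one in
    that hyperplane. *)
Lemma cone_multiplicity P :
  f != 0 -> vpick P != 0 ->
  (forall v w, w \in P -> eval f (v + w) = eval f v) ->
  has_multiplicity f P d.
Proof.
move=> f0 p0 inv; set p := vpick P.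
have [k pk] : exists k, p 0 k != 0.
  apply/existsP; rewrite -negb_forall; apply: contra p0 => /forallP z.
  by apply/eqP/rowP => k; rewrite mxE; apply/eqP.
exists k => //.
pose q := f \mPo [tuple if j == k then 0 else 'X_j | j < n].
have evq v : eval q v = eval f (v - v 0 k *: delta_mx 0 k).
  rewrite comp_mpoly_meval; apply: meval_eq => j; rewrite tnth_mktuple !mxE eqxx /=.
  by case: eqP => [->|_]; rewrite ?raddf0 ?mulr1 ?subrr // mevalXU mulr0 subr0.
have -> : local_equation f p k = q.
  apply: mpoly_fun_ext => v; rewrite evq -(inv _ p (memv_pick _)).
  rewrite comp_mpoly_meval; apply: meval_eq => j; rewrite tnth_mktuple !mxE eqxx /=.
  rewrite mevalD mevalC addrC; congr (_ + _).
  by case: eqP => [->|_]; rewrite ?raddf0 ?mulr1 ?subrr // mevalXU mulr0 subr0.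
have homq : q \is d.-homog.
  apply: dhomog_comp => // j; rewrite tnth_mktuple; case: eqP => _.
    exact: dhomog0.
  by rewrite dhomogX /= mdeg1.
have q0 : q != 0.
  apply: contra f0 => /eqP q0; apply/eqP/mpoly_fun_eq0 => v.
  pose t := - (v 0 k / p 0 k).
  have : eval q (v + t *: p) = 0 by rewrite q0 raddf0.
  rewrite evq !mxE /t mulNr divfK // subrr scale0r subr0.
  by rewrite inv // rpredZ // memv_pick.
split=> [|m]; last by move/(dhomog_mf homq) => /= ->.
by exists (mlead q); rewrite ?mlead_supp //; apply: (dhomog_mf homq); rewrite mlead_supp.
Qed.

End Cones.

(** * The pencil spanned by the hyperplanes and a cone over L *)

Lemma mx11_eq0 (K : nzRingType) (x : 'M[K]_1) : (x == 0) = (x 0 0 == 0).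
Proof.
apply/eqP/eqP => [->|x0]; first by rewrite mxE.
by apply/matrixP => i j; rewrite !ord1 x0 mxE.
Qed.

Section Pencil.
Context (K : numClosedFieldType) (d N : nat) (d1 : (1 < d)%N).
Context (L : {vspace 'rV[K]_N.+1}) (P Pi : 'I_d -> {vspace 'rV[K]_N.+1}).
Context (a : 'I_d -> 'cV[K]_N.+1) (g : {mpoly K[N.+1]}).
Context
  (hP : forall i, \dim (P i) = 1%N) (hPL : forall i, (P i <= L)%VS)
  (L_Pi : forall i, (L :&: Pi i)%VS = P i) (P_inj : injective P)
  (hPiL : forall i, ~~ (L <= Pi i)%VS)
  (Pi_a : forall i v, (v \in Pi i) = (v *m a i == 0))
  (homg : g \is d.-homog)
  (g_inv : forall v l, l \in L -> eval g (v + l) = eval g v)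
  (g_smooth : forall v, grad g v = 0 -> v \in L)
  (hL : L != fullv).

Let planes : {mpoly K[N.+1]} := \prod_i linear_form (a i).

Lemma eval_planes v : eval planes v = \prod_i (v *m a i) 0 0.
Proof.
by rewrite rmorph_prod; apply: eq_bigr => i _; rewrite /= eval_linear_form.
Qed.

Lemma planes_homog : planes \is d.-homog.
Proof.
have := dhomog_prod (mf := mdeg) (dt := [tuple 1%N | i < d])
  (mt := [tuple linear_form (a i) | i < d]).
rewrite !big_tuple (eq_bigr (fun=> 1%N)) => [|i _]; last by rewrite tnth_mktuple.
rewrite sum1_card card_ord (eq_bigr (fun i => linear_form (a i))) => [|i _].
  by apply => i; rewrite !tnth_mktuple linear_homog.
by rewrite tnth_mktuple.
Qed.

Lemma planes_vanish i v : v \in Pi i -> eval planes v = 0.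
Proof.
by rewrite Pi_a => /eqP va; rewrite eval_planes (bigD1 i) //= va mxE mul0r.
Qed.

Lemma P_notin_Pi i j v : j != i -> v \in P j -> v != 0 -> v \notin Pi i.
Proof.
move=> ji vP v0; apply: contra ji => vPi; apply/eqP/P_inj.
have vPi' : v \in P i by rewrite -L_Pi memv_cap vPi (subvP (hPL j)).
by rewrite (point_eq (hP j) vP v0) (point_eq (hP i) vPi' v0).
Qed.

Lemma split_L_Pi i v : exists2 l, l \in L & v - l \in Pi i.
Proof.
have /subvPn[l lL] := hPiL i; rewrite Pi_a => la.
exists (((v *m a i) 0 0 / (l *m a i) 0 0) *: l); first exact: rpredZ.
rewrite Pi_a mulmxBl -scalemxAl.
move: (v *m a i) (l *m a i) la => x y; rewrite !mx11_eq0 => y0.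
by rewrite !mxE divfK // subrr.
Qed.

Lemma g_neq0 : g != 0.
Proof.
apply: contra hL => /eqP g0; apply/eqP/vspaceP => v; rewrite memvf.
by apply: g_smooth; apply/colP => i; rewrite mxE g0 mderiv0 raddf0 mxE.
Qed.

(** At a point of L the form g has the same expansion as at the origin, where its
    linear part vanishes as 1 < d. *)
Lemma grad_g_L v : v \in L -> grad g v = 0.
Proof.
move=> vL; apply: grad_eq0 => w; rewrite (grad_ext (g := g) (v' := 0) (w' := w)).
  by rewrite (grad_origin homg) ?mulmx0.
by move=> t; rewrite addrC g_inv // add0r.
Qed.

Context (c : K) (c0 : c != 0).
Let F := c *: planes + g.

Lemma F_homog : F \is d.-homog.
Proof. by apply: rpredD => //; apply/rpredZ/planes_homog. Qed.

Lemma F_Pi i v : v \in Pi i -> eval F v = eval g v.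
Proof. by move=> vPi; rewrite mevalD mevalZ (planes_vanish vPi) mulr0 add0r. Qed.

Lemma F_P i v : v \in P i -> eval F v = 0.
Proof.
rewrite -L_Pi memv_cap => /andP[vL vPi].
by rewrite (F_Pi vPi) -[v]add0r g_inv // (eval_origin homg) // ltnW.
Qed.

(** The scalar is c times the product of the other l_j at v, nonzero because no
    other Pi_j passes through P_i. *)
Lemma grad_F_P i v : v \in P i -> v != 0 ->
  exists2 s, s != 0 & grad F v = s *: a i.
Proof.
move=> vP v0; have := vP; rewrite -L_Pi memv_cap => /andP[vL vPi].
exists (c * \prod_(j | j != i) (v *m a j) 0 0).
  rewrite mulf_neq0 //; apply/prodf_neq0 => j ji; apply/negP => /eqP va.
  have ij : i != j by rewrite eq_sym.
  have /negP := P_notin_Pi ij vP v0; apply; rewrite Pi_a.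
  by rewrite mx11_eq0 va.
rewrite gradD (grad_g_L vL) addr0 gradZ -scalerA; congr (_ *: _).
rewrite /planes (bigD1 i) //= gradM eval_linear_form grad_linear_form.
have /eqP -> : v *m a i == 0 by rewrite -Pi_a.
rewrite mxE scale0r addr0 rmorph_prod; congr (_ *: _).
by apply: eq_bigr => j _; rewrite /= eval_linear_form.
Qed.

Lemma a_neq0 i : a i != 0.
Proof.
apply: contra (hPiL i) => /eqP ai0; apply/subvP => v _.
by rewrite Pi_a ai0 mulmx0.
Qed.

Lemma grad_F_P_neq0 i v : v \in P i -> v != 0 -> grad F v != 0.
Proof.
move=> vP v0; have [s s0 ->] := grad_F_P vP v0.
by rewrite scaler_eq0 negb_or s0 a_neq0.
Qed.

(** At a singular point on Pi_i, F and g agree along Pi_i and g is constant along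
    L; together these directions span, so g is singular there and the point lies
    on L, hence is P_i. *)
Lemma F_smooth :
  (forall v, eval F v = 0 -> grad F v = 0 -> eval planes v = 0) -> smooth F.
Proof.
move=> pencil Q dQ FQ; split => //; apply/negP => /eqP dF.
have Fv : eval F (vpick Q) = 0 by apply: FQ; apply: memv_pick.
have v0 := vpick_neq0 dQ; set v := vpick Q in Fv v0 dF.
have /eqP := pencil v Fv dF; rewrite eval_planes => /prodf_eq0[i _ /eqP va].
have vPi : v \in Pi i by rewrite Pi_a mx11_eq0 va.
have vL : v \in L.
  apply/g_smooth/grad_eq0 => w; have [l lL wl] := split_L_Pi i w.
  rewrite -[w](subrK l) mulmxDl.
  rewrite -(grad_ext (f := F) (v := v) (w := w - l)); last first.
    by move=> t; rewrite (@F_Pi i) // rpredD // rpredZ.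
  rewrite (grad_ext (g := g) (w := l) (v' := v) (w' := 0)); last first.
    by move=> t; rewrite scaler0 addr0 g_inv // rpredZ.
  by rewrite -[grad F v]/(gradient F Q) dF mulmx0 mul0mx addr0.
have vP : v \in P i by rewrite -L_Pi memv_cap vL.
by have /negP := grad_F_P_neq0 vP v0; apply; apply/eqP.
Qed.

(** Otherwise the differential of F at P_i, a nonzero multiple of l_i, would
    vanish on L. *)
Lemma F_not_contains_L (i : 'I_d) : ~ contains F L.
Proof.
move=> FL; set p := vpick (P i).
have [pP p0] := (memv_pick (P i), vpick_neq0 (hP i)).
have pL := subvP (hPL i) _ pP.
have /subvPn[l lL] := hPiL i; rewrite Pi_a => /negP; apply.
have [s s0 dF] := grad_F_P pP p0.
have : l *m grad F p = (0 : 'rV_N.+1) *m grad F p.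
  by apply: grad_ext => t; rewrite !FL // rpredD // rpredZ // rpred0.
rewrite mul0mx dF -scalemxAr => /eqP.
by rewrite scaler_eq0 (negbTE s0).
Qed.

Lemma F_tangent i : tangent_hyperplane F (P i) = Pi i.
Proof.
apply/vspaceP => v; rewrite mem_ker Pi_a.
have [s s0] := grad_F_P (memv_pick (P i)) (vpick_neq0 (hP i)).
by rewrite -[grad _ _]/(gradient F (P i)) => ->; rewrite -scalemxAr scaler_eq0 (negbTE s0).
Qed.

Lemma F_smooth_point i : smooth_point F (P i).
Proof.
split=> [v|]; first exact: F_P.
exact: grad_F_P_neq0 (memv_pick (P i)) (vpick_neq0 (hP i)).
Qed.

Lemma eval_section f (U : {vspace 'rV[K]_N.+1}) (w : 'rV_(\dim U)) :
  eval (section f U) w = eval f (w *m basis_mx U).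
Proof. exact: eval_pullback. Qed.

Lemma F_multiplicity i :
  has_multiplicity (section F (Pi i)) (in_coords (Pi i) (P i)) d.
Proof.
have evs (w : 'rV_(\dim (Pi i))) : eval (section F (Pi i)) w =
    eval g (w *m basis_mx (Pi i)).
  by rewrite eval_section (@F_Pi i) // basis_mx_in.
apply: cone_multiplicity; first exact: (pullback_homog _ F_homog).
- apply/negP => /eqP s0; have /negP := g_neq0; apply.
  apply/eqP/mpoly_fun_eq0 => v; have [l lL] := split_L_Pi i v.
  case/basis_mxP => w vw; rewrite -[v](subrK l) g_inv // vw -evs.
  by rewrite s0 raddf0.
- rewrite vpick0; apply/negP => /eqP Q0.
  have pPi : vpick (P i) \in Pi i.
    by apply: subvP (memv_pick (P i)); rewrite -L_Pi capvSr.
  have [w pw] := basis_mxP pPi.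
  have : w \in in_coords (Pi i) (P i) by rewrite mem_in_coords -pw memv_pick.
  rewrite Q0 memv0 => /eqP w0.
  by have /negP := vpick_neq0 (hP i); apply; rewrite pw w0 mul0mx.
move=> v w; rewrite mem_in_coords => wP; rewrite !evs mulmxDl g_inv //.
exact: subvP (hPL i) _ wP.
Qed.

End Pencil.

(** * A general member of the pencil *)

(** Any c transcendental over the coefficients of f and g will do; it is nonzero
    because 0 is algebraic. *)
Lemma general_member (R : realType) n (f g : {mpoly (complex R)[n]}) :
  exists2 c : complex R, c != 0 & forall v : 'rV_n,
    eval (c *: f + g) v = 0 -> grad (c *: f + g) v = 0 -> eval f v = 0.
Proof.
pose s := [seq f@_m | m <- msupp f] ++ [seq g@_m | m <- msupp g].
have [S [phi im_phi]] := countable_subring s.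
have [c trc] := exists_transcendental phi.
exists c => [|v Fv dFv].
  apply/eqP => c0; have := trc 'X; rewrite map_polyX rootX c0 eqxx => /(_ isT).
  by apply/eqP; rewrite polyX_eq0.
apply: (pencil_critical_point trc) Fv _ => [m mf|m mg|i].
- by apply: im_phi; rewrite mem_cat; apply/orP; left; apply/mapP; exists m.
- by apply: im_phi; rewrite mem_cat; apply/orP; right; apply/mapP; exists m.
by move/colP/(_ i): dFv; rewrite !mxE.
Qed.

(** * Extending a cone in a hyperplane to a cone over L *)

Section ConeOverL.
Context (K : numClosedFieldType) (n d : nat) (d0 : (0 < d)%N).
Context (L P U : {vspace 'rV[K]_n}) (a : 'cV[K]_n) (p : 'rV[K]_n).
Context (L_U : (L :&: U)%VS = P) (U_a : forall v, (v \in U) = (v *m a == 0)).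
Context (pL : p \in L) (pU : p \notin U).

(** M takes v to the coordinates in U of its projection along p, which is
    v - (v a / p a) p. *)
Lemma projection_along : exists M : 'M[K]_(n, \dim U),
  basis_mx U *m M = 1%:M /\
  forall v, exists r, v *m M *m basis_mx U = v - r *: p.
Proof.
have pa : (p *m a) 0 0 != 0 by rewrite -mx11_eq0 -U_a.
set B := basis_mx U.
exists ((1%:M - ((p *m a) 0 0)^-1 *: (a *m p)) *m pinvmx B); split.
  have Ba : B *m a = 0.
    apply/row_matrixP => i; rewrite row0 row_mul; apply/eqP.
    by rewrite -U_a -(mul1mx B) row_mul basis_mx_in.
  rewrite mulmxA mulmxBr mulmx1 -scalemxAr [B *m (a *m p)]mulmxA Ba mul0mx.
  rewrite scaler0 subr0.
  by rewrite mulmxVp ?basis_mx_free.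
move=> v; exists ((v *m a) 0 0 / (p *m a) 0 0).
have -> : v *m ((1%:M - ((p *m a) 0 0)^-1 *: (a *m p)) *m pinvmx B) =
    (v - ((v *m a) 0 0 / (p *m a) 0 0) *: p) *m pinvmx B.
  rewrite mulmxA mulmxBr mulmx1 -scalemxAr [v *m (a *m p)]mulmxA [in LHS](mx11_scalar (v *m a)).
  by rewrite mul_scalar_mx scalerA [_^-1 * _]mulrC.
have /basis_mxP[w ->] : v - ((v *m a) 0 0 / (p *m a) 0 0) *: p \in U.
  rewrite U_a mulmxBl -scalemxAl; move: (v *m a) (p *m a) pa => x y y0.
  by rewrite mx11_eq0 !mxE divfK // subrr.
by rewrite mulmxKp ?basis_mx_free.
Qed.

Context (C : {mpoly K[\dim U]}) (homC : C \is d.-homog)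
  (coneC : good_cone C (in_coords U P)).

(** Pull C back along the projection onto U from a point of L outside U.  The
    projection maps L to the vertex L cap U, which makes the result invariant
    under L.  If the pullback is singular at v then C is singular at the image
    of v, which must be the vertex (or zero), and so v is in L. *)
Lemma extend_good_cone : exists g : {mpoly K[n]},
  [/\ g \is d.-homog, section g U = C,
      forall v l, l \in L -> eval g (v + l) = eval g v
    & forall v, grad g v = 0 -> v \in L].
Proof.
have [isC smC] := coneC; have [M [BM MB]] := projection_along.
exists (pullback M C); split.
- exact: pullback_homog.
- apply: mpoly_fun_ext => w; rewrite [LHS]eval_pullback eval_pullback.
  by rewrite -mulmxA BM mulmx1.
- move=> v l lL; rewrite !eval_pullback mulmxDl.
  apply: (cone_translate homC _ isC).
  rewrite mem_in_coords -L_U memv_cap basis_mx_in andbT.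
  by have [r ->] := MB l; rewrite rpredB // rpredZ.
move=> v dv; have Cv : eval C (v *m M) = 0.
  by rewrite -eval_pullback (euler (pullback_homog M homC)).
have dC : grad C (v *m M) = 0.
  by apply: grad_eq0 => w; rewrite -[w]mulmx1 -BM mulmxA -grad_pullback dv mulmx0.
have [r vMB] := MB v.
have toL : v *m M *m basis_mx U \in L -> v \in L.
  by rewrite vMB => vL; rewrite -[v](subrK (r *: p)) rpredD // rpredZ.
have [vM0|vM0] := eqVneq (v *m M) 0.
  by apply: toL; rewrite vM0 mul0mx mem0v.
pose Q := <[v *m M]>%VS.
have dQ : \dim Q = 1%N by rewrite dim_vline vM0.
have [QP|QP] := eqVneq Q (in_coords U P).
  apply: toL; have : v *m M \in in_coords U P by rewrite -QP memv_line.
  by rewrite mem_in_coords -L_U memv_cap => /andP[].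
have [_ /negP[]] := smC Q dQ QP (contains_line homC Cv).
have [s Es] := vlineP _ _ (memv_pick Q).
have s0 : s != 0.
  by apply: contraNneq (vpick_neq0 dQ) => s0; rewrite Es s0 scale0r.
by rewrite -[gradient _ _]/(grad C (vpick Q)) Es (grad_scale homC s0 dC).
Qed.

End ConeOverL.

(** * Existence of the hypersurface *)

(** The choice of c is isolated as a hypothesis: this is the only place where the
    uncountability of the field enters. *)
Theorem star_point_hypersurface (K : numClosedFieldType) (d N : nat)
    (d1 : (1 < d)%N) (N1 : (1 < N)%N)
    (general_member : forall f g : {mpoly K[N.+1]}, exists2 c : K, c != 0 &
      forall v : 'rV_N.+1, eval (c *: f + g) v = 0 -> grad (c *: f + g) v = 0 ->
        eval f v = 0)
    (L : {vspace 'rV[K]_N.+1}) (hL : \dim L = 2%N)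
    (P : 'I_d -> {vspace 'rV[K]_N.+1})
    (hP : forall i, \dim (P i) = 1%N) (P_inj : injective P)
    (hPL : forall i, (P i <= L)%VS)
    (Pi : 'I_d -> {vspace 'rV[K]_N.+1})
    (hPi : forall i, \dim (Pi i) = N)
    (hPiL : forall i, ~~ (L <= Pi i)%VS)
    (hPPi : forall i, (P i <= Pi i)%VS)
    (i1 : 'I_d)
    (C1 : hypersurface K (\dim (Pi i1)) d)
    (hC1 : good_cone C1 (in_coords (Pi i1) (P i1))) :
  exists X : hypersurface K N.+1 d,
    [/\ smooth X,
        ~ contains X L,
        forall i, star_point X (P i),
        forall i, tangent_hyperplane X (P i) = Pi i
      & same_hypersurface (section X (Pi i1)) C1].
Proof.
have L_Pi i : (L :&: Pi i)%VS = P i.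
  apply/esym/eqP; rewrite eqEdim subv_cap hPL hPPi hP /= -ltnS -hL.
  rewrite ltnNge; apply: contra (hPiL i) => dL.
  have /eqP <- : (L :&: Pi i)%VS == L by rewrite eqEdim capvSl.
  exact: capvSr.
have L_proper : L != fullv.
  apply: contraTneq N1 => LV; rewrite -ltnNge.
  by have := hL; rewrite LV dimvf /dim /= mul1n => -[->].
have /fin_all_exists[a Pi_a] i := hyperplane_equation (hPi i).
have d0 : (0 < d)%N := ltnW d1.
(* Any second point on L serves as the centre of projection onto Pi i1. *)
have [i2 i21] : exists i2 : 'I_d, i2 != i1.
  have [e|ne] := eqVneq i1 (Ordinal d0); last by exists (Ordinal d0); rewrite eq_sym.
  by exists (Ordinal d1); rewrite e.
have p2 := P_notin_Pi hP hPL L_Pi P_inj i21 (memv_pick _) (vpick_neq0 (hP i2)).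
have p2L := subvP (hPL i2) _ (memv_pick _).
have [g [homg gC1 g_inv g_smooth]] :=
  extend_good_cone d0 (L_Pi i1) (Pi_a i1) p2L p2 (equation_homog C1) hC1.
have [c c0 gen] := general_member (\prod_i linear_form (a i)) g.
set F := (c *: _ + g) in gen.
have homF : F \is d.-homog by apply: F_homog.
have F0 : F != 0.
  apply: contra_not_neq (F_not_contains_L d1 hP hPL L_Pi P_inj hPiL Pi_a homg g_inv c0 i1).
  by move=> F0 v _; rewrite -/F F0 raddf0.
have tanF i : tangent_hyperplane F (P i) = Pi i by apply: F_tangent.
exists (Hypersurface F0 homF); split => //=.
- by apply: F_smooth gen.
- exact: F_not_contains_L.
- move=> i; rewrite /star_point /= tanF; split; first exact: F_smooth_point.
  exact: F_multiplicity.
exists 1; rewrite ?oner_neq0 // scale1r -gC1; apply: mpoly_fun_ext => w.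
by rewrite !eval_section (F_Pi g Pi_a c (basis_mx_in w)).
Qed.

Local Open Scope complex_scope.

Theorem proposition3p3 (R : realType) (d N : nat)
    (hd : (3 <= d)%N) (hN : (3 <= N)%N)
    (L : {vspace 'rV[R[i]]_N.+1}) (hL : \dim L = 2%N)
    (P : 'I_d -> {vspace 'rV[R[i]]_N.+1})
    (hP : forall i, \dim (P i) = 1%N) (P_inj : injective P)
    (hPL : forall i, (P i <= L)%VS)
    (Pi : 'I_d -> {vspace 'rV[R[i]]_N.+1})
    (hPi : forall i, \dim (Pi i) = N)
    (hPiL : forall i, ~~ (L <= Pi i)%VS)
    (hPPi : forall i, (P i <= Pi i)%VS)
    (i1 : 'I_d) (hi1 : nat_of_ord i1 = 0%N)
    (C1 : hypersurface R[i] (\dim (Pi i1)) d)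
    (hC1 : good_cone C1 (in_coords (Pi i1) (P i1))) :
  exists X : hypersurface R[i] N.+1 d,
    [/\ smooth X,
        ~ contains X L,
        forall i, star_point X (P i),
        forall i, tangent_hyperplane X (P i) = Pi i
      & same_hypersurface (section X (Pi i1)) C1].
Proof.
exact: (star_point_hypersurface (ltnW hd) (ltnW hN) (@general_member R N.+1) hL hP P_inj hPL hPi
  hPiL hPPi hC1).
Qed.
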